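(* Let $\gamma(u,t)$ be a solution, with closed Legendrian initial curve, of the flow $$\frac{\partial\gamma}{\partial t}=-k^{-1}J\dot\gamma-2\Big(\int_0^s k^{-1}\,ds\Big)T$$ in the first Heisenberg group $\mathbb M(0)$. Then $\tilde\gamma(u,t)=\delta_{e^{-t}}(\gamma(u,t))$ satisfies the equation $$\frac{\partial\tilde\gamma}{\partial t}=-\big(\tilde k^{-1}+g_\theta(\tilde\gamma,J\dot{\tilde\gamma})\big)J\dot{\tilde\gamma}-2\Big(\int_0^{\tilde s}\tilde k^{-1}\,d\tilde s+g_\theta(\tilde\gamma,T)\Big)T .$$
   Context: The first Heisenberg group $\mathbb M(0)$ is $\mathbb R^3$ with coordinates $(x,y,z)$ and contact form $\theta=x\,dy-y\,dx+dz$. Set $X_1=\partial_x+y\partial_z$, $X_2=\partial_y-x\partial_z$, $T=\partial_z$ (the Reeb field). $g_\theta$ is the Riemannian metric for which $\{X_1,X_2,T\}$ is orthonormal; $J$ is given by $JX_1=X_2$, $JX_2=-X_1$, $JT=0$. $\nabla$ is the Tanaka connection, for which $X_1,X_2,T$ are parallel. The dilations are $\delta_\lambda(p_1,p_2,p_3)=(\lambda p_1,\lambda p_2,\lambda^2p_3)$, $\lambda>0$. For a curve $\gamma$, $s$ is the arc-length parameter with respect to $g_\theta$, measured from a base point of $S^1$, $\dot\gamma=\partial\gamma/\partial s$, and $k=g_\theta(\nabla_{\dot\gamma}\dot\gamma,J\dot\gamma)$ is the curvature; $\gamma$ is Legendrian if $g_\theta(\dot\gamma,T)\equiv0$. In the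 flow, $k,s,\dot\gamma$ refer to $\gamma(\cdot,t)$. Correspondingly, $\tilde s$, $\dot{\tilde\gamma}=\partial\tilde\gamma/\partial\tilde s$ and $\tilde k$ are the arc length, unit tangent and curvature of $\tilde\gamma(\cdot,t)$. In $g_\theta(\tilde\gamma,\cdot)$, $\tilde\gamma$ denotes the position vector field $\tilde\gamma^1\partial_x+\tilde\gamma^2\partial_y+\tilde\gamma^3\partial_z=\tilde\gamma^1X_1+\tilde\gamma^2X_2+\tilde\gamma^3T$ along the curve.
   Formalization: The printed equation omits a tangential term and fails as an exact equality for closed Legendrian initial curves; the formal statement adds −g_θ(γ̃, γ̃′)γ̃′ (γ̃′ the unit tangent) to the right-hand side, so the printed equation holds modulo tangential motion. *)

(* Defs.v *)
From Stdlib Require Import Reals.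
From Coquelicot Require Import Coquelicot.
Open Scope R_scope.

(* Points of the Heisenberg group and tangent vectors are both triples of
   coordinates; a tangent vector is written in the basis d/dx, d/dy, d/dz. *)
Definition vec : Type := (R * R * R)%type.

Definition cx (p : vec) : R := fst (fst p).
Definition cy (p : vec) : R := snd (fst p).
Definition cz (p : vec) : R := snd p.

Definition theta (p v : vec) : R := cx p * cy v - cy p * cx v + cz v.

Definition X1 (p : vec) : vec := (1, 0, cy p).
Definition X2 (p : vec) : vec := (0, 1, - cx p).
Definition T (p : vec) : vec := (0, 0, 1).

(* The vector at p with components a, b, c in the frame X1, X2, T.
   The components of v are recovered as (cx v, cy v, theta p v), because
   dx, dy, theta is the coframe dual to X1, X2, T. *)
Definition from_frame (p : vec) (a b c : R) : vec :=
  plus (plus (scal a (X1 p)) (scal b (X2 p))) (scal c (T p)).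

Definition metric (p v w : vec) : R :=
  cx v * cx w + cy v * cy w + theta p v * theta p w.

Definition J (p v : vec) : vec := from_frame p (- cy v) (cx v) 0.

Definition dilation (lam : R) (p : vec) : vec :=
  (lam * cx p, lam * cy p, lam ^ 2 * cz p).

(* Curves are parametrized by u in R, the universal cover of the circle
   R / (2 PI Z).  Periodicity is required separately, by [closed_curve]. *)

Definition closed_curve (c : R -> vec) : Prop :=
  forall u, c (u + 2 * PI) = c u.

Definition velocity (c : R -> vec) (u : R) : vec :=
  (Derive (fun v => cx (c v)) u,
   Derive (fun v => cy (c v)) u,
   Derive (fun v => cz (c v)) u).

Definition speed (c : R -> vec) (u : R) : R :=
  sqrt (metric (c u) (velocity c u) (velocity c u)).

(* Arc length s satisfies ds = speed du, so d/ds = (1 / speed) d/du. *)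
Definition unit_tangent (c : R -> vec) (u : R) : vec :=
  scal (/ speed c u) (velocity c u).

(* Tanaka covariant derivative, with respect to arc length, of a vector field
   V along c: the frame X1, X2, T being parallel, one differentiates the frame
   components of V. *)
Definition nabla_s (c V : R -> vec) (u : R) : vec :=
  scal (/ speed c u)
    (from_frame (c u)
       (Derive (fun v => cx (V v)) u)
       (Derive (fun v => cy (V v)) u)
       (Derive (fun v => theta (c v) (V v)) u)).

Definition curvature (c : R -> vec) (u : R) : R :=
  metric (c u) (nabla_s c (unit_tangent c) u) (J (c u) (unit_tangent c u)).

Definition legendrian (c : R -> vec) : Prop :=
  forall u, metric (c u) (unit_tangent c u) (T (c u)) = 0.

(* The integral of 1 / k with respect to arc length from the base point u0. *)
Definition int_inv_curvature (u0 : R) (c : R -> vec) (u : R) : R :=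
  RInt (fun v => / curvature c v * speed c v) u0 u.

Definition flow_velocity (u0 : R) (c : R -> vec) (u : R) : vec :=
  minus (scal (- / curvature c u) (J (c u) (unit_tangent c u)))
        (scal (2 * int_inv_curvature u0 c u) (T (c u))).

(* In [metric (c u) (c u) _] the second [c u] is the position vector. *)
Definition rescaled_flow_velocity (u0 : R) (c : R -> vec) (u : R) : vec :=
  minus
    (scal (- (/ curvature c u + metric (c u) (c u) (J (c u) (unit_tangent c u))))
          (J (c u) (unit_tangent c u)))
    (scal (2 * (int_inv_curvature u0 c u + metric (c u) (c u) (T (c u))))
          (T (c u))).

(* The rescaling moves a point with the extra velocity
   - (cx, cy, 2 cz) = - cx X1 - cy X2 - 2 cz T.  Its components along J gamma'
   and T are the extra terms of [rescaled_flow_velocity]; its component along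
   the unit tangent is the vector below, which only moves points along the
   curve and is dropped when flows are written modulo tangential motion. *)
Definition tangential_velocity (c : R -> vec) (u : R) : vec :=
  scal (- metric (c u) (c u) (unit_tangent c u)) (unit_tangent c u).

Definition time_interval (Tmax : Rbar) (t : R) : Prop :=
  0 <= t /\ Rbar_lt t Tmax.

(* f'(t) = l for f on [0, Tmax); the derivative is one-sided at t = 0. *)
Definition is_time_derive (Tmax : Rbar) (f : R -> vec) (t : R) (l : vec) : Prop :=
  filterdiff f (within (time_interval Tmax) (locally t)) (fun h => scal h l).

(* Smoothness on R x [0, Tmax): D i j is the partial derivative of order i in
   u and j in t. *)
Definition smooth_family (Tmax : Rbar) (gam : R -> R -> vec) : Prop :=
  exists D : nat -> nat -> R -> R -> vec,
    (forall u t, time_interval Tmax t -> D 0%nat 0%nat u t = gam u t) /\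
    forall i j u t, time_interval Tmax t ->
      is_derive (fun v => D i j v t) u (D (S i) j u t) /\
      is_time_derive Tmax (D i j u) t (D i (S j) u t) /\
      filterlim (fun p : R * R => D i j (fst p) (snd p))
        (within (fun p : R * R => time_interval Tmax (snd p)) (locally (u, t)))
        (locally (D i j u t)).

(* A smooth family of immersed curves of nonvanishing curvature solving
   d gam / dt = V (gam (., t)).  Nonvanishing of speed and curvature is what
   gives unit tangent and 1 / k their meaning.  The curves gam (., t), t > 0,
   are not required to be closed: V may involve an integral from a base point,
   which need not vanish over a full period. *)
Definition is_solution (Tmax : Rbar) (V : (R -> vec) -> R -> vec)
    (gam : R -> R -> vec) : Prop :=
  smooth_family Tmax gam /\
  forall u t, time_interval Tmax t ->
    let c := fun v => gam v t in
    0 < speed c u /\ curvature c u <> 0 /\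
    is_time_derive Tmax (gam u) t (V c u).

(* Main.v *)
Require Import Defs.
From Stdlib Require Import Reals Lra.
From Coquelicot Require Import Coquelicot.
Open Scope R_scope.

(** The dilation by lam multiplies horizontal components by lam and vertical
    ones by lam^2, so speed and curvature scale in a simple way only on
    Legendrian curves.  Hence the heart of the matter is that the flow keeps
    Legendrian curves Legendrian.  Write c' for the unit tangent, k for the
    curvature and f = theta (gam_u) at a fixed parameter u.  Since
    d theta = 2 dx /\ dy,

      f_t = (theta (gam_t))_u + 2 (x_t y_u - y_t x_u).

    The T component of the flow is - 2 int k^-1 ds, so the first term is
    - 2 k^-1 speed; the component - k^-1 J c' makes the second one
    2 k^-1 (x_u^2 + y_u^2) / speed, where x_u^2 + y_u^2 = speed^2 - f^2.
    Hence f_t = - 2 k^-1 f^2 / speed ([theta_evolution]).  This is a linear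
    equation f_t = g f with the continuous coefficient g = - 2 f / (k speed),
    and f vanishes at time 0, so it vanishes always ([legendrian_preserved]).

    On a Legendrian curve the dilation by lam multiplies the speed by lam and
    divides the curvature by lam ([speed_dilation], [curvature_dilation]);
    therefore it multiplies int k^-1 ds by lam^2.  The time derivative of
    dilation (exp (- t)) (gam u t) is the dilated flow velocity plus the field
    - (x, y, 2 z) at the rescaled point; the coefficients of this field in the
    orthonormal frame c', J c', T are the tangential velocity and the two extra
    terms of the rescaled flow ([rescaled_velocity_eq]).

    Smoothness is given by a compatible table of partial derivatives, so that
    mixed partial derivatives agree by definition.  A table for the rescaled
    family comes from tables for its horizontal and vertical parts, which are
    multiplied by exp (- t) and exp (- 2 t), through repeated use of
    (exp (- w t) p)_t = exp (- w t) (p_t - w p) ([jet_decay]). *)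

(** * Derivatives of vector-valued curves *)

(* The normed module carried by vec, for lemmas whose structure arguments
   unification cannot find. *)
Local Notation vec_module :=
  (prod_NormedModule R_AbsRing
    (prod_NormedModule R_AbsRing R_NormedModule R_NormedModule) R_NormedModule).

Ltac coords :=
  unfold plus, minus, opp, scal, mult, zero; simpl;
  unfold prod_plus, prod_opp, prod_scal, prod_zero, plus, minus, opp, scal, mult, zero; simpl;
  unfold prod_plus, prod_opp, prod_scal, prod_zero, plus, minus, opp, scal, mult, zero; simpl;
  unfold plus, opp, scal, mult, zero; simpl.

Lemma is_linear_cx : is_linear cx.
Proof.
  apply (is_linear_comp fst fst); apply is_linear_fst.
Qed.

Lemma is_linear_cy : is_linear cy.
Proof. apply (is_linear_comp fst snd); [apply is_linear_fst|apply is_linear_snd]. Qed.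

Lemma is_linear_cz : is_linear cz.
Proof. apply is_linear_snd. Qed.

(** One statement for both kinds of derivative in use: F is a full neighbourhood
    filter for derivatives in u, and its trace on the time interval for
    one-sided derivatives in t. *)
Lemma filterdiff_comp_linear {U V : NormedModule R_AbsRing}
    (F : (R -> Prop) -> Prop) (FF : Filter F) (A : U -> V) (f : R -> U) (l : U) :
  is_linear A -> filterdiff f F (fun h : R => scal h l) ->
  filterdiff (fun s : R => A (f s)) F (fun h : R => scal h (A l)).
Proof.
  intros HA Hf.
  eapply filterdiff_ext_lin.
  - exact (filterdiff_comp f A _ _ Hf (filterdiff_linear _ HA)).
  - intros h; apply (linear_scal A HA).
Qed.

Lemma is_derive_linear (A : vec -> vec) (c : R -> vec) u l :
  is_linear A -> is_derive c u l -> is_derive (fun v : R => A (c v)) u (A l).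
Proof.
  exact (filterdiff_comp_linear (U := vec_module) (V := vec_module) _ _ A c l).
Qed.

Lemma is_derive_coordinate (A : vec -> R) (c : R -> vec) u l :
  is_linear A -> is_derive c u l -> is_derive (fun v : R => A (c v)) u (A l).
Proof.
  exact (filterdiff_comp_linear (U := vec_module) (V := R_NormedModule)
    _ _ A c l).
Qed.

Lemma is_derive_coordinates (c : R -> vec) (u : R) (l : vec) :
  is_derive c u l ->
  is_derive (fun v => cx (c v)) u (cx l) /\
  is_derive (fun v => cy (c v)) u (cy l) /\
  is_derive (fun v => cz (c v)) u (cz l).
Proof.
  intros H; split; [|split]; apply is_derive_coordinate;
    auto using is_linear_cx, is_linear_cy, is_linear_cz.
Qed.

(** The point t itself lies in every set of the filter, also at an end point of
    the interval. *)
Lemma within_interval_proper Tmax t :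
  time_interval Tmax t ->
  ProperFilter (within (time_interval Tmax) (locally t)).
Proof.
  intros Ht; split.
  - intros P HP; exists t; exact (locally_singleton _ _ HP Ht).
  - apply within_filter, locally_filter.
Qed.

Lemma within_interval_lim Tmax t :
  is_filter_lim (within (time_interval Tmax) (locally t)) t.
Proof. intros P HP; apply (filter_le_within _ _ HP). Qed.

Lemma locally_time_interval Tmax t :
  0 < t -> Rbar_lt t Tmax -> locally t (time_interval Tmax).
Proof.
  intros H0 HT; apply filter_and.
  - apply (filter_imp (fun s => 0 < s)); [intros; lra|].
    apply (open_gt 0); exact H0.
  - destruct Tmax as [T0| |]; simpl in *.
    + apply (open_lt T0); exact HT.
    + apply filter_true.
    + easy.
Qed.

Lemma is_time_derive_interior Tmax f t l :
  0 < t -> Rbar_lt t Tmax -> is_time_derive Tmax f t l -> is_derive f t l.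
Proof.
  intros H0 HT [Hlin Hdom]; split; [exact Hlin|].
  intros x Hx.
  eapply is_domin_le.
  - apply Hdom; intros P HP; apply filter_le_within, Hx, HP.
  - intros P HP.
    generalize (filter_and _ _ (locally_time_interval Tmax t H0 HT) HP).
    apply filter_imp; intros r [Hr HPr]; exact (HPr Hr).
Qed.

Lemma is_time_derive_linear Tmax f t l (A : vec -> vec) :
  is_linear A -> is_time_derive Tmax f t l ->
  is_time_derive Tmax (fun s => A (f s)) t (A l).
Proof.
  apply (filterdiff_comp_linear (U := vec_module) (V := vec_module)).
  apply within_filter, locally_filter.
Qed.

Lemma is_time_derive_plus Tmax f g t lf lg :
  is_time_derive Tmax f t lf -> is_time_derive Tmax g t lg ->
  is_time_derive Tmax (fun s => plus (f s) (g s)) t (plus lf lg).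
Proof.
  intros Hf Hg.
  eapply filterdiff_ext_lin.
  - exact (filterdiff_plus_fct _ _ _ _ Hf Hg).
  - intros h; simpl; symmetry; apply (scal_distr_l h lf lg).
Qed.

(** The product rule, which has to be redone for the restricted filter: the
    derivative of multiplication is taken along the image of that filter under
    s |-> (exp (- (w * s)), f s). *)
Lemma is_time_derive_decay Tmax w f t l :
  time_interval Tmax t -> is_time_derive Tmax f t l ->
  is_time_derive Tmax (fun s => scal (exp (- (w * s))) (f s)) t
    (scal (exp (- (w * t))) (plus l (scal (- w) (f t)))).
Proof.
  intros Ht Hf.
  pose proof (within_interval_proper Tmax t Ht) as PF.
  pose proof (within_interval_lim Tmax t) as Hlim.
  assert (He : filterdiff (fun s => exp (- (w * s)))
    (within (time_interval Tmax) (locally t))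
    (fun h => scal h (- w * exp (- (w * t))))).
  { apply (filterdiff_locally _ t _ Hlim).
    change (is_derive (fun s => exp (- (w * s))) t (- w * exp (- (w * t)))).
    auto_derive; [easy | ring]. }
  assert (Ce : filterlim (fun s => exp (- (w * s)))
    (within (time_interval Tmax) (locally t)) (locally (exp (- (w * t)))))
    by (eapply filterlim_filter_le_1; [apply filter_le_within|];
        apply (ex_derive_continuous (fun s => exp (- (w * s))));
        auto_derive; easy).
  assert (Cf : filterlim f (within (time_interval Tmax) (locally t))
    (locally (f t)))
    by (apply (fun H => filterdiff_continuous_aux f H t Hlim);
        eexists; exact Hf).
  eapply filterdiff_ext_lin.
  - apply (filterdiff_comp_2 (T := R_NormedModule) (U := R_NormedModule)
      _ _ (fun (k : R) (v : vec) => scal k v) _ _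
      (fun (k : R) (v : vec) => plus (scal k (f t)) (scal (exp (- (w * t))) v))
      He Hf).
    apply (filterdiff_scal (exp (- (w * t)), f t)).
    + intros P HP.
      apply (filterlim_pair _ _ Ce Cf).
      destruct HP as [eps HP].
      exists (ball (exp (- (w * t))) eps) (ball (f t) eps);
        try apply locally_ball.
      intros; apply HP; split; assumption.
    + exact Rmult_comm.
  - intros h.
    destruct (f t) as [[a b] c], l as [[a' b'] c'].
    coords; repeat apply f_equal2; ring.
Qed.

(** * Tables of derivatives *)

Definition is_jet Tmax (D : nat -> nat -> R -> R -> vec) : Prop :=
  forall i j u t, time_interval Tmax t ->
    is_derive (fun v => D i j v t) u (D (S i) j u t) /\
    is_time_derive Tmax (D i j u) t (D i (S j) u t) /\
    filterlim (fun p : R * R => D i j (fst p) (snd p))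
      (within (fun p : R * R => time_interval Tmax (snd p)) (locally (u, t)))
      (locally (D i j u t)).

Lemma jet_linear Tmax D (A : vec -> vec) :
  is_linear A -> is_jet Tmax D -> is_jet Tmax (fun i j u t => A (D i j u t)).
Proof.
  intros HA HD i j u t Ht; destruct (HD i j u t Ht) as [Hu [Htd Hc]].
  split; [|split].
  - exact (is_derive_linear A _ _ _ HA Hu).
  - exact (is_time_derive_linear _ _ _ _ A HA Htd).
  - eapply filterlim_comp; [exact Hc|].
    apply (filterdiff_continuous A).
    eexists; apply filterdiff_linear, HA.
Qed.

Lemma jet_plus Tmax D E :
  is_jet Tmax D -> is_jet Tmax E ->
  is_jet Tmax (fun i j u t => plus (D i j u t) (E i j u t)).
Proof.
  intros HD HE i j u t Ht.
  destruct (HD i j u t Ht) as [Hu [Htd Hc]].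
  destruct (HE i j u t Ht) as [Hu' [Htd' Hc']].
  split; [|split].
  - exact (is_derive_plus _ _ _ _ _ Hu Hu').
  - exact (is_time_derive_plus _ _ _ _ _ _ Htd Htd').
  - eapply filterlim_comp_2; [exact Hc | exact Hc' |].
    exact (filterlim_plus (V := vec_module) (D i j u t) (E i j u t)).
Qed.

(** The n-th power of the operator d/dt - w, applied to a whole table. *)
Fixpoint decay_jet (w : R) (D : nat -> nat -> R -> R -> vec) (n i j : nat)
    (u t : R) : vec :=
  match n with
  | O => D i j u t
  | S n => plus (decay_jet w D n i (S j) u t)
                (scal (- w) (decay_jet w D n i j u t))
  end.

Lemma decay_jet_is_jet Tmax w D n :
  is_jet Tmax D -> is_jet Tmax (decay_jet w D n).
Proof.
  intros HD; induction n as [|n IH]; [exact HD|].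
  apply (jet_plus Tmax (fun i j => decay_jet w D n i (S j))
           (fun i j u t => scal (- w) (decay_jet w D n i j u t))).
  - intros i j; exact (IH i (S j)).
  - apply jet_linear; [|exact IH].
    exact (is_linear_scal_r (V := vec_module) (- w) Rmult_comm).
Qed.

(** Conjugation by exp (- w t) turns d/dt into d/dt - w, so the j-th time
    derivative needs the j-th power of that operator. *)
Lemma jet_decay Tmax w D :
  is_jet Tmax D ->
  is_jet Tmax (fun i j u t => scal (exp (- (w * t))) (decay_jet w D j i 0 u t)).
Proof.
  intros HD i j u t Ht.
  destruct (decay_jet_is_jet Tmax w D j HD i 0%nat u t Ht) as [Hu [Htd Hc]].
  split; [|split].
  - apply (is_derive_linear (fun p : vec => scal (exp (- (w * t))) p));
      [|exact Hu].
    exact (is_linear_scal_r (V := vec_module) _ Rmult_comm).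
  - exact (is_time_derive_decay _ w _ _ _ Ht Htd).
  - apply (filterlim_comp_2 (F := within _ (locally (u, t)))
      (G := locally (exp (- (w * t)))) (H := locally (decay_jet w D j i 0 u t))
      (fun p : R * R => exp (- (w * snd p)))
      (fun p => decay_jet w D j i 0 (fst p) (snd p)) scal).
    + eapply filterlim_filter_le_1; [apply filter_le_within|].
      apply (filterlim_comp _ _ _ snd (fun s => exp (- (w * s))) _ (locally t)).
      * exact (continuous_snd u t).
      * apply (ex_derive_continuous (fun s => exp (- (w * s)))).
        auto_derive; easy.
    + exact Hc.
    + exact (filterlim_scal (V := vec_module) (exp (- (w * t)))
        (decay_jet w D j i 0 u t)).
Qed.

(** * Linear ordinary differential equations *)

(** For b >= 0, precomposition with this retraction onto [0, b] extends a
    function that is continuous on [0, b] to a continuous function on R, so that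
    the two-sided notions of continuity and integral apply. *)
Definition clamp (b s : R) : R := Rmin b (Rmax 0 s).

Lemma clamp_id b s : 0 <= s <= b -> clamp b s = s.
Proof.
  intros H; unfold clamp; rewrite Rmax_right by lra.
  apply Rmin_right; lra.
Qed.

Lemma continuous_clamp b s : continuous (clamp b) s.
Proof.
  intros P [eps HP]; exists eps; intros r Hr; apply HP.
  revert Hr; unfold ball; simpl; unfold AbsRing_ball, abs, minus, plus, opp; simpl.
  unfold clamp, Rmin, Rmax; intros Hr.
  repeat destruct Rle_dec; split_Rabs; lra.
Qed.

Lemma clamp_in_interval Tmax b s :
  time_interval Tmax b -> time_interval Tmax (clamp b s).
Proof.
  intros [Hb HT]; unfold clamp; split.
  - apply Rmin_glb; [exact Hb|apply Rmax_l].
  - apply (Rbar_le_lt_trans _ b); [apply Rmin_l|exact HT].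
Qed.

Lemma continuous_comp_clamp Tmax (f : R -> R) b s :
  time_interval Tmax b ->
  (forall r, time_interval Tmax r ->
    filterlim f (within (time_interval Tmax) (locally r)) (locally (f r))) ->
  continuous (fun r => f (clamp b r)) s.
Proof.
  intros Hb Hf.
  apply (filterlim_comp _ _ _ (clamp b) f _
    (within (time_interval Tmax) (locally (clamp b s)))).
  - intros P HP.
    generalize (continuous_clamp b s _ HP); unfold filtermap.
    apply filter_imp; intros r Hr; apply Hr, clamp_in_interval, Hb.
  - apply Hf, clamp_in_interval, Hb.
Qed.

(** The integrating factor exp (- int g) makes f exp (- int g) constant. *)
Lemma linear_ode_zero (f g : R -> R) b :
  0 < b -> (forall s, continuous f s) -> (forall s, continuous g s) ->
  (forall s, 0 < s < b -> is_derive f s (g s * f s)) ->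
  f 0 = 0 -> f b = 0.
Proof.
  intros Hb Hf Hg Hd H0.
  assert (HG : forall s, is_derive (RInt g 0) s (g s)).
  { intros s; apply (is_derive_RInt g _ 0 s); [|apply Hg].
    apply filter_forall; intros r; apply (RInt_correct (V := R_CompleteNormedModule)).
    apply (ex_RInt_continuous (V := R_CompleteNormedModule)); auto. }
  assert (HE : forall s, is_derive (fun r => exp (- RInt g 0 r)) s
    (- g s * exp (- RInt g 0 s))).
  { intros s.
    apply (is_derive_comp (V := R_NormedModule) exp (fun r => - RInt g 0 r)
             s (exp (- RInt g 0 s)) (- g s)).
    - apply is_derive_Reals, derivable_pt_lim_exp.
    - apply (is_derive_opp (RInt g 0)), HG. }
  destruct (MVT_gen (fun s => f s * exp (- RInt g 0 s)) 0 b (fun _ => 0))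
    as [_ [_ E]].
  - rewrite Rmin_left, Rmax_right by lra; intros s Hs; evar_last.
    + apply @is_derive_mult; [apply Hd, Hs | apply HE | exact Rmult_comm].
    + coords; ring.
  - intros s _; apply continuity_pt_filterlim.
    apply (continuous_mult f (fun r => exp (- RInt g 0 r))); [apply Hf|].
    apply (ex_derive_continuous (V := R_NormedModule)); eexists; apply HE.
  - rewrite H0 in E.
    assert (E' : f b * exp (- RInt g 0 b) = 0) by lra.
    apply Rmult_integral in E'; destruct E' as [E'|E']; [exact E'|].
    pose proof (exp_pos (- RInt g 0 b)); lra.
Qed.

(** * Frame components *)

Lemma cx_plus v w : cx (plus v w) = cx v + cx w.
Proof. reflexivity. Qed.

Lemma cy_plus v w : cy (plus v w) = cy v + cy w.
Proof. reflexivity. Qed.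

Lemma cx_minus v w : cx (minus v w) = cx v - cx w.
Proof. reflexivity. Qed.

Lemma cy_minus v w : cy (minus v w) = cy v - cy w.
Proof. reflexivity. Qed.

Lemma cx_scal k v : cx (scal k v) = k * cx v.
Proof. reflexivity. Qed.

Lemma cy_scal k v : cy (scal k v) = k * cy v.
Proof. reflexivity. Qed.

Lemma from_frame_components p a b d :
  cx (from_frame p a b d) = a /\ cy (from_frame p a b d) = b /\
  theta p (from_frame p a b d) = d.
Proof.
  unfold theta, from_frame, X1, X2, T, cx, cy, cz; coords.
  repeat split; ring.
Qed.

Lemma theta_scal p k v : theta p (scal k v) = k * theta p v.
Proof. unfold theta, cx, cy, cz; coords; ring. Qed.

Lemma theta_minus p v w : theta p (minus v w) = theta p v - theta p w.
Proof. unfold theta, cx, cy, cz; coords; ring. Qed.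

Lemma theta_plus p v w : theta p (plus v w) = theta p v + theta p w.
Proof. unfold theta, cx, cy, cz; coords; ring. Qed.

Lemma theta_T p : theta p (T p) = 1.
Proof. unfold theta, T, cx, cy, cz; simpl; ring. Qed.

Lemma theta_J p v : theta p (J p v) = 0.
Proof. exact (proj2 (proj2 (from_frame_components p (- cy v) (cx v) 0))). Qed.

Lemma eq_of_coframe p v w :
  cx v = cx w -> cy v = cy w -> theta p v = theta p w -> v = w.
Proof.
  destruct v as [[a b] d], w as [[a' b'] d'].
  unfold theta, cx, cy, cz; simpl; intros -> -> E.
  f_equal; lra.
Qed.

Lemma metric_self_nonneg p v : 0 <= metric p v v.
Proof. unfold metric; nra. Qed.

(** * Speed, curvature and the curvature integral of a curve *)

Lemma velocity_eq (c : R -> vec) (u : R) (l : vec) :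
  is_derive c u l -> velocity c u = l.
Proof.
  intros H; destruct (is_derive_coordinates c u l H) as [Hx [Hy Hz]].
  destruct l as [[a b] d]; unfold velocity.
  apply f_equal2; [apply f_equal2|]; apply is_derive_unique; assumption.
Qed.

Lemma speed_sqr (c : R -> vec) (u : R) (l : vec) :
  is_derive c u l -> speed c u * speed c u = metric (c u) l l.
Proof.
  intros H; unfold speed; rewrite (velocity_eq c u l H).
  apply sqrt_sqrt, metric_self_nonneg.
Qed.

(** The product rule gives theta (p, q') plus the determinant of the horizontal
    parts of p' and q.  Taken once along t and once along u, these determinants
    have opposite signs; their difference is d theta = 2 dx /\ dy. *)
Lemma is_derive_theta (p q : R -> vec) (s : R) (p' q' : vec) :
  is_derive p s p' -> is_derive q s q' ->
  is_derive (fun r => theta (p r) (q r)) s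
    (theta (p s) q' + (cx p' * cy (q s) - cy p' * cx (q s))).
Proof.
  intros H1 H2.
  destruct (is_derive_coordinates _ _ _ H1) as [Hx [Hy Hz]].
  destruct (is_derive_coordinates _ _ _ H2) as [Hx1 [Hy1 Hz1]].
  unfold theta.
  evar_last.
  - apply @is_derive_plus; [apply @is_derive_minus|exact Hz1];
    apply @is_derive_mult; eauto using Rmult_comm.
  - coords; ring.
Qed.

Lemma ex_derive_speed (c c1 : R -> vec) (u : R) (c2u : vec) :
  (forall v, is_derive c v (c1 v)) -> is_derive c1 u c2u ->
  0 < speed c u -> ex_derive (speed c) u.
Proof.
  intros H1 H2 Hs.
  destruct (is_derive_coordinates _ _ _ H2) as [Hx1 [Hy1 _]].
  pose proof (is_derive_theta c c1 u _ _ (H1 u) H2) as Hth.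
  apply (ex_derive_ext (fun v => sqrt (metric (c v) (c1 v) (c1 v)))).
  { intros v; unfold speed; rewrite (velocity_eq c v _ (H1 v)); reflexivity. }
  pose proof (speed_sqr c u _ (H1 u)) as Hq; unfold metric in *.
  eexists; evar_last.
  - apply @is_derive_sqrt; [|nra].
    apply @is_derive_plus; [apply @is_derive_plus|];
    apply @is_derive_mult; eauto using Rmult_comm.
  - reflexivity.
Qed.

(** The derivative of 1 / speed multiplies the unit tangent itself and so drops
    out against J; what is left is the planar curvature formula for the
    projection to the (x, y) plane, with the full speed in the denominator. *)
Lemma curvature_formula (c c1 : R -> vec) (u : R) (c2u : vec) :
  (forall v, is_derive c v (c1 v)) -> is_derive c1 u c2u ->
  0 < speed c u ->
  curvature c u =
    (cx (c1 u) * cy c2u - cy (c1 u) * cx c2u) / speed c u ^ 3.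
Proof.
  intros H1 H2 Hs.
  destruct (ex_derive_speed c c1 u c2u H1 H2 Hs) as [s' Hs'].
  assert (Htan : forall (A : vec -> R), is_linear A ->
    Derive (fun v => A (unit_tangent c v)) u =
    (A c2u * speed c u - A (c1 u) * s') / speed c u ^ 2).
  { intros A HA.
    rewrite (Derive_ext _ (fun v => A (c1 v) / speed c v)).
    - apply is_derive_unique, is_derive_div; [|exact Hs'|lra].
      apply is_derive_coordinate; assumption.
    - intros v; unfold unit_tangent; rewrite (velocity_eq c v _ (H1 v)).
      rewrite (linear_scal A HA); coords; unfold Rdiv; ring. }
  unfold curvature, nabla_s, J.
  rewrite (Htan cx is_linear_cx), (Htan cy is_linear_cy).
  unfold metric; rewrite theta_scal.
  rewrite (linear_scal cx is_linear_cx), (linear_scal cy is_linear_cy).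
  repeat match goal with |- context [from_frame ?p ?a ?b ?d] =>
    destruct (from_frame_components p a b d) as [-> [-> ->]] end.
  unfold unit_tangent; rewrite (velocity_eq c u _ (H1 u)).
  rewrite (linear_scal cx is_linear_cx), (linear_scal cy is_linear_cy).
  coords; field; lra.
Qed.

Lemma legendrian_theta_eq_0 (c : R -> vec) (u : R) (l : vec) :
  is_derive c u l -> 0 < speed c u ->
  metric (c u) (unit_tangent c u) (T (c u)) = 0 -> theta (c u) l = 0.
Proof.
  intros H Hs; unfold metric, unit_tangent.
  rewrite (velocity_eq c u l H), !theta_scal.
  replace (cx (T (c u))) with 0 by reflexivity.
  replace (cy (T (c u))) with 0 by reflexivity.
  replace (theta (c u) (T (c u))) with 1 by (unfold theta, T, cx, cy, cz; simpl; ring).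
  intros E; assert (E' : / speed c u * theta (c u) l = 0) by lra.
  apply Rmult_integral in E'; destruct E' as [E'|E']; [|exact E'].
  exfalso; apply (Rinv_neq_0_compat (speed c u)); [lra|exact E'].
Qed.

Lemma continuous_inv_curvature (c c1 c2 c3 : R -> vec) u :
  (forall v, is_derive c v (c1 v)) -> (forall v, is_derive c1 v (c2 v)) ->
  (forall v, is_derive c2 v (c3 v)) ->
  (forall v, 0 < speed c v) -> curvature c u <> 0 ->
  continuous (fun v => / curvature c v * speed c v) u.
Proof.
  intros H1 H2 H3 Hs Hk.
  pose proof (ex_derive_speed c c1 u _ H1 (H2 u) (Hs u)) as [s' Hs'].
  destruct (is_derive_coordinates _ _ _ (H2 u)) as [Hx1 [Hy1 _]].
  destruct (is_derive_coordinates _ _ _ (H3 u)) as [Hx2 [Hy2 _]].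
  apply (ex_derive_continuous (V := R_NormedModule)).
  apply (ex_derive_mult (fun v => / curvature c v) (speed c));
    [|eexists; exact Hs'].
  apply (ex_derive_inv (curvature c)); [|exact Hk].
  apply (ex_derive_ext (fun v =>
    (cx (c1 v) * cy (c2 v) - cy (c1 v) * cx (c2 v)) / speed c v ^ 3)).
  { intros v; symmetry; apply curvature_formula; auto. }
  assert (0 < speed c u ^ 3) by (apply pow_lt, Hs).
  eexists.
  apply is_derive_div; [|apply is_derive_pow; exact Hs' | lra].
  apply @is_derive_minus; apply @is_derive_mult; eauto using Rmult_comm.
Qed.

Lemma is_derive_int_inv_curvature (c c1 c2 c3 : R -> vec) u0 u :
  (forall v, is_derive c v (c1 v)) -> (forall v, is_derive c1 v (c2 v)) ->
  (forall v, is_derive c2 v (c3 v)) ->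
  (forall v, 0 < speed c v) -> (forall v, curvature c v <> 0) ->
  is_derive (int_inv_curvature u0 c) u (/ curvature c u * speed c u).
Proof.
  intros H1 H2 H3 Hs Hk.
  assert (Hc : forall v, continuous (fun v => / curvature c v * speed c v) v)
    by (intros v; apply (continuous_inv_curvature c c1 c2 c3); auto).
  apply (is_derive_RInt (fun v => / curvature c v * speed c v) _ u0 u);
    [|apply Hc].
  apply filter_forall; intros v; apply (RInt_correct (V := R_CompleteNormedModule)).
  apply (ex_RInt_continuous (V := R_CompleteNormedModule)); auto.
Qed.

(** * Legendrian curves stay Legendrian *)

Lemma flow_velocity_components u0 (c : R -> vec) (u : R) (l : vec) :
  is_derive c u l ->
  cx (flow_velocity u0 c u) = / curvature c u * / speed c u * cy l /\
  cy (flow_velocity u0 c u) = - (/ curvature c u * / speed c u * cx l) /\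
  theta (c u) (flow_velocity u0 c u) = - 2 * int_inv_curvature u0 c u.
Proof.
  intros H; unfold flow_velocity, unit_tangent; rewrite (velocity_eq c u l H).
  unfold J, theta, from_frame, X1, X2, T, cx, cy, cz; coords.
  repeat split; ring.
Qed.

(** The u-derivative of theta (gam_t) = - 2 int k^-1 ds contains the mixed
    derivative gam_ut, and so does the t-derivative of theta (gam_u); eliminating
    it leaves - 2 speed / k plus twice a determinant of first derivatives. *)
Lemma theta_evolution Tmax u0 gam D u t :
  is_solution Tmax (flow_velocity u0) gam ->
  (forall u t, time_interval Tmax t -> D 0%nat 0%nat u t = gam u t) ->
  is_jet Tmax D ->
  0 < t -> Rbar_lt t Tmax ->
  let c := fun v => gam v t in
  is_derive (fun s => theta (D 0%nat 0%nat u s) (D 1%nat 0%nat u s)) t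
    (- 2 * / curvature c u * / speed c u * theta (gam u t) (D 1%nat 0%nat u t) ^ 2).
Proof.
  intros [_ Hsol] HD0 HD H0 HT c.
  assert (Ht : time_interval Tmax t) by (split; [lra|exact HT]).
  assert (Hsp : forall v, 0 < speed c v) by (intros v; apply (Hsol v t Ht)).
  assert (Hk : forall v, curvature c v <> 0) by (intros v; apply (Hsol v t Ht)).
  assert (H1 : forall v, is_derive c v (D 1%nat 0%nat v t)).
  { intros v; eapply is_derive_ext; [|apply (HD 0%nat 0%nat v t Ht)].
    intros r; apply (HD0 r t Ht). }
  assert (H2 : forall v, is_derive (fun v => D 1%nat 0%nat v t) v (D 2%nat 0%nat v t))
    by (intros v; apply (HD 1%nat 0%nat v t Ht)).
  assert (H3 : forall v, is_derive (fun v => D 2%nat 0%nat v t) v (D 3%nat 0%nat v t))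
    by (intros v; apply (HD 2%nat 0%nat v t Ht)).
  assert (HV : forall v, D 0%nat 1%nat v t = flow_velocity u0 c v).
  { intros v.
    (* Both sides are the velocity of the path s |-> gam v s at s = t. *)
    rewrite <- (velocity_eq (D 0%nat 0%nat v) t (D 0%nat 1%nat v t))
      by exact (is_time_derive_interior _ _ _ _ H0 HT (proj1 (proj2 (HD _ _ v t Ht)))).
    apply velocity_eq.
    apply (is_derive_ext_loc (gam v)).
    - generalize (locally_time_interval Tmax t H0 HT); apply filter_imp.
      intros s Hs; symmetry; apply HD0, Hs.
    - exact (is_time_derive_interior _ _ _ _ H0 HT (proj2 (proj2 (Hsol v t Ht)))). }
  pose proof (HD 0%nat 1%nat u t Ht) as [HVu _].
  pose proof (is_derive_theta c _ u _ _ (H1 u) HVu) as Hspace.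
  assert (Hint : is_derive (fun v => theta (c v) (D 0%nat 1%nat v t)) u
    (- 2 * (/ curvature c u * speed c u))).
  { apply (is_derive_ext (fun v => - 2 * int_inv_curvature u0 c v)).
    - intros v; rewrite HV.
      symmetry; apply (flow_velocity_components u0 c v _ (H1 v)).
    - apply is_derive_scal.
      exact (is_derive_int_inv_curvature c _ _ _ u0 u H1 H2 H3 Hsp Hk). }
  apply is_derive_unique in Hspace; apply is_derive_unique in Hint.
  rewrite Hint in Hspace.
  evar_last.
  - apply (is_derive_theta (D 0%nat 0%nat u) (D 1%nat 0%nat u)).
    + exact (is_time_derive_interior _ _ _ _ H0 HT (proj1 (proj2 (HD _ _ u t Ht)))).
    + exact (is_time_derive_interior _ _ _ _ H0 HT (proj1 (proj2 (HD _ _ u t Ht)))).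
  - rewrite HV in Hspace |- *.
    destruct (flow_velocity_components u0 c u _ (H1 u)) as [Ex [Ey _]].
    rewrite Ex, Ey in Hspace |- *.
    rewrite HD0 by exact Ht; fold (c u); change (gam u t) with (c u).
    pose proof (speed_sqr c u _ (H1 u)) as Hq; unfold metric in Hq.
    set (f := theta (c u) (D 1%nat 0%nat u t)) in *.
    specialize (Hsp u); specialize (Hk u).
    set (k := curvature c u) in *; set (q := speed c u) in *.
    set (a := cx (D 1%nat 0%nat u t)) in *.
    set (b := cy (D 1%nat 0%nat u t)) in *.
    replace (f ^ 2) with (q * q - a * a - b * b) by lra.
    replace (-2 * / k * / q * (q * q - a * a - b * b)) with
      (-2 * (/ k * q) + 2 * / k * / q * (a * a + b * b)) by (field; lra).
    rewrite Hspace; ring.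
Qed.

Ltac continuous_algebra := repeat
  match goal with
  | |- continuous (fun r => @?g r + @?h r) _ =>
      apply (continuous_plus (V := R_NormedModule) g h)
  | |- continuous (fun r => @?g r - @?h r) _ =>
      apply (continuous_minus (V := R_NormedModule) g h)
  | |- continuous (fun r => @?g r * @?h r) _ =>
      apply (continuous_mult (K := R_AbsRing) g h)
  end.

Lemma jet_coordinate_continuous Tmax D (A : vec -> R) i u b s :
  is_linear A -> is_jet Tmax D -> time_interval Tmax b ->
  continuous (fun r => A (D i 0%nat u (clamp b r))) s.
Proof.
  intros HA HD Hb.
  apply (continuous_comp_clamp Tmax (fun r => A (D i 0%nat u r)) b s Hb).
  intros r Hr; eapply filterlim_comp.
  - apply (fun H => filterdiff_continuous_aux (D i 0%nat u) H r
             (within_interval_lim Tmax r)).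
    eexists; exact (proj1 (proj2 (HD i 0%nat u r Hr))).
  - apply (filterdiff_continuous (V := R_NormedModule) A).
    eexists; apply filterdiff_linear, HA.
Qed.

Lemma is_derive_slice Tmax gam D t v :
  (forall u t, time_interval Tmax t -> D 0%nat 0%nat u t = gam u t) ->
  is_jet Tmax D -> time_interval Tmax t ->
  is_derive (fun v : R => gam v t) v (D 1%nat 0%nat v t).
Proof.
  intros HD0 HD Ht; eapply is_derive_ext; [|apply (HD 0%nat 0%nat v t Ht)].
  intros r; apply (HD0 r t Ht).
Qed.

Lemma legendrian_preserved Tmax u0 gam D u t :
  legendrian (fun v => gam v 0) ->
  is_solution Tmax (flow_velocity u0) gam ->
  (forall u t, time_interval Tmax t -> D 0%nat 0%nat u t = gam u t) ->
  is_jet Tmax D ->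
  time_interval Tmax t -> theta (gam u t) (D 1%nat 0%nat u t) = 0.
Proof.
  intros Hleg Hsol HD0 HD Ht.
  assert (Hslice := fun t v => is_derive_slice Tmax gam D t v HD0 HD).
  assert (Hinit : theta (gam u 0) (D 1%nat 0%nat u 0) = 0).
  { assert (Hz : time_interval Tmax 0).
    { split; [lra|]. apply (Rbar_le_lt_trans _ t); apply Ht. }
    apply (legendrian_theta_eq_0 (fun v => gam v 0)).
    - apply Hslice, Hz.
    - apply (proj2 Hsol u 0 Hz).
    - apply Hleg. }
  destruct (Req_dec t 0) as [->|Hne]; [exact Hinit|].
  assert (H0 : 0 < t) by (destruct Ht; lra).
  assert (Hcont := fun A i s HA => jet_coordinate_continuous Tmax D A i u t s HA HD Ht).
  set (f := fun s => theta (D 0%nat 0%nat u s) (D 1%nat 0%nat u s)).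
  (* m is the square of the speed and d is k speed^3; in these terms the
     coefficient - 2 f / (k speed) of the linear equation is - 2 (m / d) f,
     whose continuity in time can be read off from the table D. *)
  set (m := fun s => cx (D 1%nat 0%nat u s) * cx (D 1%nat 0%nat u s)
    + cy (D 1%nat 0%nat u s) * cy (D 1%nat 0%nat u s) + f s * f s).
  set (d := fun s => cx (D 1%nat 0%nat u s) * cy (D 2%nat 0%nat u s)
    - cy (D 1%nat 0%nat u s) * cx (D 2%nat 0%nat u s)).
  assert (Hfm : forall s, time_interval Tmax s ->
     f s = theta (gam u s) (D 1%nat 0%nat u s) /\
     m s = speed (fun v => gam v s) u ^ 2 /\
     d s = curvature (fun v => gam v s) u * speed (fun v => gam v s) u ^ 3).
  { intros s Hs; unfold m, d, f; rewrite (HD0 u s Hs).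
    pose proof (speed_sqr _ _ _ (Hslice s u Hs)) as Hq; unfold metric in Hq.
    destruct (proj2 Hsol u s Hs) as [Hsp _].
    split; [reflexivity|split].
    - simpl; rewrite Rmult_1_r; symmetry; exact Hq.
    - match goal with |- ?d = _ * ?q ^ 3 =>
        replace d with (d / q ^ 3 * q ^ 3) by (field; lra) end.
      f_equal; symmetry.
      exact (curvature_formula _ _ u _ (fun v => Hslice s v Hs)
        (proj1 (HD 1%nat 0%nat u s Hs)) Hsp). }
  assert (Hd : forall s, time_interval Tmax s -> d s <> 0).
  { intros s Hs; destruct (Hfm s Hs) as [_ [_ ->]].
    destruct (proj2 Hsol u s Hs) as [Hsp [Hk _]].
    apply Rmult_integral_contrapositive; split; [exact Hk|].
    apply pow_nonzero; lra. }
  rewrite <- (proj1 (Hfm t Ht)).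
  rewrite <- (clamp_id t t) by lra.
  assert (Hcf : forall s, continuous (fun r => f (clamp t r)) s).
  { intros s; unfold f, theta; continuous_algebra;
      apply Hcont; auto using is_linear_cx, is_linear_cy, is_linear_cz. }
  apply (linear_ode_zero (fun s => f (clamp t s))
    (fun s => - 2 * (m (clamp t s) * / d (clamp t s)) * f (clamp t s)) t H0 Hcf).
  - intros s.
    assert (Hcd : continuous (fun r => / d (clamp t r)) s).
    { apply (continuous_comp (fun r => d (clamp t r)) Rinv).
      - unfold d; continuous_algebra;
          apply Hcont; auto using is_linear_cx, is_linear_cy.
      - apply continuous_Rinv, Hd, clamp_in_interval, Ht. }
    assert (Hcm : continuous (fun r => m (clamp t r)) s).
    { unfold m; continuous_algebra;
      lazymatch goal with
      | |- continuous (fun r => f _) _ => exact (Hcf s)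
      | _ => apply Hcont; auto using is_linear_cx, is_linear_cy
      end. }
    continuous_algebra;
      [apply continuous_const | exact Hcm | exact Hcd | exact (Hcf s)].
  - intros s Hs.
    assert (Hs' : time_interval Tmax s).
    { split; [lra|]. apply (Rbar_lt_trans _ t); [simpl; lra|apply Ht]. }
    apply (is_derive_ext_loc f).
    + apply (filter_imp (fun r => 0 < r /\ r < t)).
      * intros r Hr; rewrite clamp_id; [reflexivity|lra].
      * apply filter_and; [apply (open_gt 0)|apply (open_lt t)]; lra.
    + rewrite clamp_id by lra.
      evar_last.
      * exact (theta_evolution Tmax u0 gam D u s Hsol HD0 HD (proj1 Hs) (proj2 Hs')).
      * destruct (Hfm s Hs') as [Ef [-> ->]].
        destruct (proj2 Hsol u s Hs') as [Hsp [Hk _]].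
        rewrite Ef; field; split; [lra|exact Hk].
  - rewrite clamp_id by lra.
    unfold f; rewrite HD0; [exact Hinit|].
    split; [lra|]; apply (Rbar_le_lt_trans _ t); apply Ht.
Qed.

(** * The rescaled flow *)

Definition horizontal_part (p : vec) : vec := (cx p, cy p, 0).
Definition vertical_part (p : vec) : vec := (0, 0, cz p).

Lemma is_linear_horizontal_part : is_linear horizontal_part.
Proof.
  apply (is_linear_prod (fun p : vec => (cx p, cy p)) (fun _ => 0)).
  - apply (is_linear_prod cx cy); [exact is_linear_cx|exact is_linear_cy].
  - apply (is_linear_zero (V := R_NormedModule)).
Qed.

Lemma is_linear_vertical_part : is_linear vertical_part.
Proof.
  apply (is_linear_prod (fun p : vec => (0, 0)) cz).
  - apply (is_linear_zero (V := prod_NormedModule _ R_NormedModule R_NormedModule)).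
  - exact is_linear_cz.
Qed.

Lemma dilation_decay t p :
  dilation (exp (- t)) p =
  plus (scal (exp (- (1 * t))) (horizontal_part p))
       (scal (exp (- (2 * t))) (vertical_part p)).
Proof.
  unfold dilation, horizontal_part, vertical_part.
  replace (exp (- (2 * t))) with (exp (- t) ^ 2)
    by (simpl; rewrite Rmult_1_r, <- exp_plus; f_equal; ring).
  rewrite Rmult_1_l; coords.
  repeat apply f_equal2; ring.
Qed.

Lemma smooth_family_rescaled Tmax gam :
  smooth_family Tmax gam ->
  smooth_family Tmax (fun u t => dilation (exp (- t)) (gam u t)).
Proof.
  intros [D [HD0 HD]].
  pose proof (jet_decay Tmax 1 _ (jet_linear _ _ _ is_linear_horizontal_part HD)) as Hh.
  pose proof (jet_decay Tmax 2 _ (jet_linear _ _ _ is_linear_vertical_part HD)) as Hv.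
  eexists; split; [|exact (jet_plus _ _ _ Hh Hv)].
  intros u t Ht; simpl; rewrite HD0 by exact Ht.
  symmetry; apply dilation_decay.
Qed.

Lemma is_time_derive_ext Tmax f g t l :
  (forall s, f s = g s) -> is_time_derive Tmax f t l -> is_time_derive Tmax g t l.
Proof. apply filterdiff_ext. Qed.

Lemma is_time_derive_dilation Tmax f t l :
  time_interval Tmax t -> is_time_derive Tmax f t l ->
  is_time_derive Tmax (fun s => dilation (exp (- s)) (f s)) t
    (dilation (exp (- t)) (minus l (cx (f t), cy (f t), 2 * cz (f t)))).
Proof.
  intros Ht Hf.
  eapply is_time_derive_ext; [intros s; symmetry; apply dilation_decay|].
  rewrite dilation_decay.
  replace (plus _ _) with
   (plus (scal (exp (- (1 * t))) (plus (horizontal_part l) (scal (- 1) (horizontal_part (f t)))))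
     (scal (exp (- (2 * t))) (plus (vertical_part l) (scal (- 2) (vertical_part (f t)))))).
  - apply is_time_derive_plus; apply is_time_derive_decay; try exact Ht.
    + exact (is_time_derive_linear _ _ _ _ _ is_linear_horizontal_part Hf).
    + exact (is_time_derive_linear _ _ _ _ _ is_linear_vertical_part Hf).
  - destruct (f t) as [[a b] c], l as [[a' b'] c'].
    unfold horizontal_part, vertical_part, cx, cy, cz; coords.
    repeat apply f_equal2; ring.
Qed.

Lemma is_linear_dilation lam : is_linear (dilation lam).
Proof.
  apply (is_linear_prod (fun p : vec => (lam * cx p, lam * cy p))
           (fun p => lam ^ 2 * cz p)).
  - apply (is_linear_prod (fun p : vec => lam * cx p) (fun p => lam * cy p)).
    + apply (is_linear_comp cx (fun x => scal lam x)); [exact is_linear_cx|].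
      exact (is_linear_scal_r (V := R_NormedModule) lam Rmult_comm).
    + apply (is_linear_comp cy (fun x => scal lam x)); [exact is_linear_cy|].
      exact (is_linear_scal_r (V := R_NormedModule) lam Rmult_comm).
  - apply (is_linear_comp cz (fun x => scal (lam ^ 2) x)); [exact is_linear_cz|].
    exact (is_linear_scal_r (V := R_NormedModule) (lam ^ 2) Rmult_comm).
Qed.

Lemma theta_dilation lam p v :
  theta (dilation lam p) (dilation lam v) = lam ^ 2 * theta p v.
Proof. unfold theta, dilation, cx, cy, cz; simpl; ring. Qed.

(** The vertical part of the velocity, which would scale by lam^2, is zero. *)
Lemma speed_dilation lam (c : R -> vec) (u : R) (l : vec) :
  0 < lam -> is_derive c u l -> theta (c u) l = 0 ->
  speed (fun v => dilation lam (c v)) u = lam * speed c u.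
Proof.
  intros Hlam H Hth.
  unfold speed.
  rewrite (velocity_eq _ _ _ H),
    (velocity_eq _ _ _ (is_derive_linear _ _ _ _ (is_linear_dilation lam) H)).
  unfold metric; rewrite theta_dilation, Hth.
  etransitivity; [|apply f_equal2; [apply (sqrt_Rsqr lam); lra|reflexivity]].
  rewrite <- sqrt_mult_alt by apply Rle_0_sqr.
  f_equal; unfold Rsqr, dilation, cx, cy; simpl; ring.
Qed.

Lemma curvature_dilation lam (c c1 : R -> vec) (u : R) (c2u : vec) :
  0 < lam -> (forall v, is_derive c v (c1 v)) -> is_derive c1 u c2u ->
  theta (c u) (c1 u) = 0 -> 0 < speed c u ->
  curvature (fun v => dilation lam (c v)) u = curvature c u / lam.
Proof.
  intros Hlam H1 H2 Hth Hs.
  pose proof (speed_dilation lam c u _ Hlam (H1 u) Hth) as Es.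
  rewrite (curvature_formula (fun v => dilation lam (c v))
    (fun v => dilation lam (c1 v)) u (dilation lam c2u)).
  - rewrite Es, (curvature_formula c c1 u c2u H1 H2 Hs).
    unfold dilation, cx, cy; simpl; field; lra.
  - intros v; apply is_derive_linear; [apply is_linear_dilation|apply H1].
  - apply is_derive_linear; [apply is_linear_dilation|exact H2].
  - rewrite Es; apply Rmult_lt_0_compat; assumption.
Qed.

(** The decomposition of - (x, y, 2 z) in the frame c', J c', T.  The terms
    1 / k and int k^-1 ds of the flow keep their form, because they scale by lam
    and lam^2, just as horizontal and vertical components of vectors do. *)
Lemma rescaled_velocity_eq lam u0 (c c1 c2 c3 : R -> vec) u :
  0 < lam ->
  (forall v, is_derive c v (c1 v)) -> (forall v, is_derive c1 v (c2 v)) ->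
  (forall v, is_derive c2 v (c3 v)) ->
  (forall v, 0 < speed c v) -> (forall v, curvature c v <> 0) ->
  (forall v, theta (c v) (c1 v) = 0) ->
  let c' := fun v => dilation lam (c v) in
  dilation lam (minus (flow_velocity u0 c u) (cx (c u), cy (c u), 2 * cz (c u)))
  = plus (rescaled_flow_velocity u0 c' u) (tangential_velocity c' u).
Proof.
  intros Hlam H1 H2 H3 Hs Hk Hth c'.
  assert (Es : forall v, speed c' v = lam * speed c v)
    by (intros v; apply (speed_dilation lam c v (c1 v)); auto).
  assert (Ek : forall v, curvature c' v = curvature c v / lam)
    by (intros v; apply (curvature_dilation lam c c1 v (c2 v)); auto).
  assert (EI : int_inv_curvature u0 c' u = lam ^ 2 * int_inv_curvature u0 c u).
  { unfold int_inv_curvature.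
    rewrite (RInt_ext _ (fun v => scal (lam ^ 2) (/ curvature c v * speed c v))).
    - apply (RInt_scal (V := R_CompleteNormedModule)).
      apply (ex_RInt_continuous (V := R_CompleteNormedModule)); intros v _.
      apply (continuous_inv_curvature c c1 c2 c3); auto.
    - intros v _; rewrite Es, Ek; unfold scal; simpl; unfold mult; simpl.
      field; split; [apply Hk|lra]. }
  assert (H1' : is_derive c' u (dilation lam (c1 u)))
    by (apply is_derive_linear; [apply is_linear_dilation|apply H1]).
  assert (Etau : cx (unit_tangent c' u) = cx (c1 u) / speed c u /\
    cy (unit_tangent c' u) = cy (c1 u) / speed c u /\
    theta (c' u) (unit_tangent c' u) = 0).
  { unfold unit_tangent; rewrite (velocity_eq _ _ _ H1'), theta_scal.
    change (c' u) with (dilation lam (c u)); rewrite theta_dilation, Hth, Es.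
    specialize (Hs u).
    unfold dilation, cx, cy, cz; coords; repeat split; field; lra. }
  destruct Etau as [Ea [Eb Eth]].
  destruct (flow_velocity_components u0 c u _ (H1 u)) as [Vx [Vy Vt]].
  destruct (from_frame_components (c' u) (- cy (unit_tangent c' u))
     (cx (unit_tangent c' u)) 0) as [Jx [Jy _]].
  fold (J (c' u) (unit_tangent c' u)) in Jx, Jy.
  pose proof (speed_sqr c u _ (H1 u)) as Hq; unfold metric in Hq.
  rewrite Hth in Hq.
  specialize (Hs u); specialize (Hk u).
  assert (Hunit : cx (c1 u) / speed c u * (cx (c1 u) / speed c u)
    + cy (c1 u) / speed c u * (cy (c1 u) / speed c u) = 1).
  { transitivity (speed c u * speed c u / (speed c u * speed c u));
      [rewrite Hq at 1|]; field; lra. }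
  pose proof (theta_J (c' u) (unit_tangent c' u)) as Jt.
  assert (Cx : cx (c' u) = lam * cx (c u)) by reflexivity.
  assert (Cy : cy (c' u) = lam * cy (c u)) by reflexivity.
  assert (Cz : theta (c' u) (c' u) = lam ^ 2 * cz (c u))
    by (unfold theta, c', dilation, cx, cy, cz; simpl; ring).
  assert (Tx : cx (T (c' u)) = 0) by reflexivity.
  assert (Ty : cy (T (c' u)) = 0) by reflexivity.
  pose proof (theta_T (c' u)) as Tt.
  assert (Ek' : / (curvature c u / lam) = lam * / curvature c u)
    by (field; lra).
  replace (/ curvature c u * / speed c u * cy (c1 u))
    with (/ curvature c u * (cy (c1 u) / speed c u)) in Vx
    by (unfold Rdiv; ring).
  replace (/ curvature c u * / speed c u * cx (c1 u))
    with (/ curvature c u * (cx (c1 u) / speed c u)) in Vy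
    by (unfold Rdiv; ring).
  unfold rescaled_flow_velocity, tangential_velocity, metric.
  rewrite EI, Ek, Ek', Jt, Jx, Jy, Eth, Ea, Eb, Cx, Cy, Cz, Tx, Ty, Tt.
  set (a := cx (c1 u) / speed c u) in *.
  set (b := cy (c1 u) / speed c u) in *.
  apply (eq_of_coframe (c' u)).
  - change (cx (dilation lam ?v)) with (lam * cx v).
    rewrite cx_plus, !cx_minus, !cx_scal, Jx, Tx, Ea, Eb, Vx.
    change (cx (cx ?p, ?q, ?r)) with (cx p).
    (* The two sides differ by a multiple of |c'|^2 - 1. *)
    apply Rminus_diag_uniq.
    transitivity (lam * cx (c u) * (a * a + b * b - 1)); [ring|].
    rewrite Hunit; ring.
  - change (cy (dilation lam ?v)) with (lam * cy v).
    rewrite cy_plus, !cy_minus, !cy_scal, Jy, Ty, Ea, Eb, Vy.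
    change (cy (?p, cy ?q, ?r)) with (cy q).
    apply Rminus_diag_uniq.
    transitivity (lam * cy (c u) * (a * a + b * b - 1)); [ring|].
    rewrite Hunit; ring.
  - rewrite theta_plus, theta_minus, !theta_scal, Jt, Tt, Eth.
    change (c' u) with (dilation lam (c u)).
    rewrite theta_dilation, theta_minus, Vt.
    unfold theta at 1; change (cz (?p, ?q, ?r)) with r.
    change (cx (?p, ?q, ?r)) with p; change (cy (?p, ?q, ?r)) with q.
    ring.
Qed.

Theorem lemma7p5 (Tmax : Rbar) (hT : Rbar_lt 0 Tmax) (u0 : R)
    (gam : R -> R -> vec)
    (hclosed : closed_curve (fun u => gam u 0))
    (hleg : legendrian (fun u => gam u 0))
    (hflow : is_solution Tmax (flow_velocity u0) gam) :
  is_solution Tmax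
    (fun c u => plus (rescaled_flow_velocity u0 c u) (tangential_velocity c u))
    (fun u t => dilation (exp (- t)) (gam u t)).
Proof.
  destruct hflow as [[D [HD0 HD]] Hsol].
  assert (Hflow : is_solution Tmax (flow_velocity u0) gam)
    by (split; [exists D; split; assumption | exact Hsol]).
  split; [apply smooth_family_rescaled, Hflow|].
  intros u t Ht c'.
  pose (c := fun v => gam v t).
  assert (H1 : forall v, is_derive c v (D 1%nat 0%nat v t))
    by (intros v; exact (is_derive_slice Tmax gam D t v HD0 HD Ht)).
  assert (H2 : forall v, is_derive (fun v => D 1%nat 0%nat v t) v (D 2%nat 0%nat v t))
    by (intros v; apply (HD 1%nat 0%nat v t Ht)).
  assert (H3 : forall v, is_derive (fun v => D 2%nat 0%nat v t) v (D 3%nat 0%nat v t))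
    by (intros v; apply (HD 2%nat 0%nat v t Ht)).
  assert (Hs : forall v, 0 < speed c v) by (intros v; apply (Hsol v t Ht)).
  assert (Hk : forall v, curvature c v <> 0) by (intros v; apply (Hsol v t Ht)).
  assert (Hth : forall v, theta (c v) (D 1%nat 0%nat v t) = 0)
    by (intros v; exact (legendrian_preserved Tmax u0 gam D v t hleg Hflow HD0 HD Ht)).
  pose proof (exp_pos (- t)) as Hlam.
  split; [|split].
  - change c' with (fun v : R => dilation (exp (- t)) (c v));
      rewrite (speed_dilation _ c u _ Hlam (H1 u) (Hth u)).
    apply Rmult_lt_0_compat; auto.
  - change c' with (fun v : R => dilation (exp (- t)) (c v));
      rewrite (curvature_dilation _ c _ u _ Hlam H1 (H2 u) (Hth u) (Hs u)).
    apply Rmult_integral_contrapositive; split; [apply Hk|].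
    apply Rinv_neq_0_compat; lra.
  - change c' with (fun v : R => dilation (exp (- t)) (c v));
      rewrite <- (rescaled_velocity_eq _ u0 c _ _ _ u Hlam H1 H2 H3 Hs Hk Hth).
    exact (is_time_derive_dilation Tmax (gam u) t _ Ht (proj2 (proj2 (Hsol u t Ht)))).
Qed.
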